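(* There exist $\varepsilon_0>0$ and functions $a:(0,\varepsilon_0)\to(0,\infty)$ and $N_0:(0,\varepsilon_0)\to(0,\infty)$ such that $a(\varepsilon)\to0$ as $\varepsilon\to0$ and the following holds. For every $\varepsilon\in(0,\varepsilon_0)$, every integer $N>N_0(\varepsilon)$ and every discrete harmonic function $u:\mathbb{Z}^2\to\mathbb{R}$, if $$|Q_N\cap\{|u|\le1\}|\ge(1-\varepsilon)|Q_N|,$$ then $$\max_{Q_{[N/2]}}|u|\le e^{a(\varepsilon)N}.$$
   Context: A function $u:\mathbb{Z}^2\to\mathbb{R}$ is discrete harmonic if its value at every point of $\mathbb{Z}^2$ equals the average of its values at the four adjacent points. For a nonnegative integer $N$, $Q_N=\{(n,m)\in\mathbb{Z}^2:|n|,|m|\le N\}$. $|S|$ is the number of elements of a finite set $S$, $\{|u|\le 1\}$ is the set of points of $\mathbb{Z}^2$ where $|u|\le1$, and $[x]$ is the integer part of $x$. *)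

(* Defs.v *)
From HB Require Import structures.
From mathcomp Require Import all_boot all_order all_algebra.
From mathcomp Require Import finmap.
From mathcomp Require Import all_classical all_reals all_analysis.
Set Implicit Arguments.
Unset Strict Implicit.
Unset Printing Implicit Defensive.
Import Order.TTheory GRing.Theory Num.Theory.
Import numFieldNormedType.Exports.
Local Open Scope classical_set_scope.
Local Open Scope ring_scope.

Definition discrete_harmonic (R : realType) (u : int * int -> R) : Prop :=
  forall n m : int,
    u (n, m) = (u (n + 1, m) + u (n - 1, m) + u (n, m + 1) + u (n, m - 1)) / 4.

Definition square (N : nat) : set (int * int) :=
  [set p | `|p.1| <= N%:Z /\ `|p.2| <= N%:Z].

Lemma finite_square (N : nat) : finite_set (square N).
Proof.
pose f (i : 'I_(N.*2.+1)) : int := (i : nat)%:Z - N%:Z.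
have fin_f : finite_set (range f) by exact/finite_image/finite_finset.
apply: (@sub_finite_set _ _ (range f `*` range f)); last exact: finite_setX.
have inf (z : int) : `|z| <= N%:Z -> range f z.
  rewrite ler_norml => /andP[zl zu].
  have z0 : 0 <= z + N%:Z by rewrite -lerBlDr sub0r.
  have zE : (absz (z + N%:Z))%:Z = z + N%:Z by rewrite gez0_abs.
  have lt : (absz (z + N%:Z)%R < N.*2.+1)%N.
    by rewrite ltnS -lez_nat zE -addnn PoszD lerD2r.
  by exists (Ordinal lt) => //; rewrite /f /= zE addrK.
by move=> [n m] [/= hn hm]; split; exact: inf.
Qed.

(* [fset_set] sends infinite sets to the empty finite set; by [finite_square],
   it is only used below on finite sets. *)
Definition card_set (A : set (int * int)) : nat := #|` fset_set A |.

(* The maximum of |u| over a nonempty finite set: the default value 0 is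
   harmless since |u| >= 0. *)
Definition max_abs (R : realType) (u : int * int -> R) (A : set (int * int)) : R :=
  \big[Num.max/0]_(p <- fset_set A) `|u p|.

(* Main.v *)
Require Import Defs.
From mathcomp Require Import all_boot all_order all_algebra.
From mathcomp Require Import finmap.
From mathcomp Require Import all_classical all_reals all_analysis.
From mathcomp Require Import ring lra zify.
Import Order.TTheory GRing.Theory Num.Theory.
Import numFieldNormedType.Exports.
Local Open Scope classical_set_scope.
Local Open Scope ring_scope.
Set Implicit Arguments.
Unset Strict Implicit.
Unset Printing Implicit Defensive.

(* In the coordinates s = x + y, t = x - y, harmonicity couples three consecutive rows
   g_j = u(s + j, .) by T g_{j+2} + T g_j = 4 g_{j+1}, where T h(t) = h(t+1) + h(t-1)
   is, up to signs, a finite difference on each parity class. If rows 0 and 1 are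
   bounded by M on a window of length w, then T^(m-1) g_m is bounded by C^m M, so g_m is
   a polynomial of degree < m plus a controlled error, and m points where |g_m| <= 1
   suffice (Lagrange interpolation) to bound g_m by C^w M on the whole window. Rows with
   too many bad points are handled through the next good row m: the Dirichlet problem
   between rows 0 and m is solved by polynomials in T whose inverses are controlled modulo
   T^(j-1), and T^(j-1) g_j is known.

   Hence a bound on the middle of a square of side l extends to the middle of a square of
   side 2l with few bad points at the cost of a factor C^l. By induction on dyadic scales,
   a square of side l in which the proportion of bad points is below an absolute constant
   has |u| <= C^l in its middle. The theorem follows by using squares whose side is
   proportional to sqrt(eps) N. *)

(** * Polynomials in the neighbour sum *)

Section TwoSidedShift.
Variable R : realType.
Implicit Types (h : int -> R) (p q : {poly R}) (t : int).

Definition nbsum h : int -> R := fun t => h (t + 1) + h (t - 1).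

(* The action of R[X] on functions in which X acts as [nbsum]. *)
Definition act p h : int -> R :=
  fun t => \sum_(i < size p) p`_i * iter i nbsum h t.

Lemma actE n p h t : (size p <= n)%N ->
  act p h t = \sum_(i < n) p`_i * iter i nbsum h t.
Proof.
move=> le_pn; rewrite /act (big_ord_widen n (fun i => p`_i * iter i nbsum h t)) //.
rewrite big_mkcond; apply: eq_bigr => i _; case: ltnP => // le_pi.
by rewrite nth_default // mul0r.
Qed.

Lemma act0 h : act 0 h = fun=> 0.
Proof. by apply/funext => t; rewrite /act size_poly0 big_ord0. Qed.

Lemma act_MXaddC p (c : R) h t : act (p * 'X + c%:P) h t = act p (nbsum h) t + c * h t.
Proof.
rewrite (@actE (size p).+1); last first.
  by rewrite size_MXaddC; case: ifP => // /andP[/eqP -> _].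
rewrite big_ord_recl coefD coefMX eqxx coefC eqxx add0r /= addrC; congr (_ + _).
apply: eq_bigr => i _; rewrite coefD coefMX coefC /= addr0.
by rewrite -iterSr.
Qed.

Lemma act_add p h1 h2 t :
  act p (fun t => h1 t + h2 t) t = act p h1 t + act p h2 t.
Proof.
elim/poly_ind: p h1 h2 => [|p c IHp] h1 h2; first by rewrite !act0 addr0.
rewrite !act_MXaddC.
have -> : nbsum (fun t => h1 t + h2 t) = (fun t => nbsum h1 t + nbsum h2 t).
  by apply/funext => t'; rewrite /nbsum; ring.
by rewrite IHp; ring.
Qed.

Lemma act_scale p (c : R) h t : act p (fun t => c * h t) t = c * act p h t.
Proof.
elim/poly_ind: p h => [|p d IHp] h; first by rewrite !act0 mulr0.
rewrite !act_MXaddC.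
have -> : nbsum (fun t => c * h t) = (fun t => c * nbsum h t).
  by apply/funext => t'; rewrite /nbsum; ring.
by rewrite IHp; ring.
Qed.

Lemma actD p q h t : act (p + q) h t = act p h t + act q h t.
Proof.
rewrite (@actE (maxn (size p) (size q))) ?size_polyD//.
rewrite !(@actE (maxn (size p) (size q))) ?leq_maxl ?leq_maxr// -big_split /=.
by apply: eq_bigr => i _; rewrite coefD mulrDl.
Qed.

Lemma actZ (c : R) p h t : act (c *: p) h t = c * act p h t.
Proof.
rewrite (@actE (size p)) ?size_scale_leq// /act mulr_sumr.
by apply: eq_bigr => i _; rewrite coefZ mulrA.
Qed.

Lemma actB p q h t : act (p - q) h t = act p h t - act q h t.
Proof. by rewrite -scaleN1r actD actZ mulN1r. Qed.

Lemma act_nbsum p h : act p (nbsum h) = nbsum (act p h).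
Proof.
apply/funext => t; rewrite /nbsum /act -big_split /=; apply: eq_bigr => i _.
by rewrite -mulrDr -iterSr iterS.
Qed.

Lemma actM p q h : act (p * q) h = act p (act q h).
Proof.
elim/poly_ind: p h => [|p c IHp] h; first by rewrite mul0r !act0.
apply/funext => t; rewrite act_MXaddC mulrDl mulrAC actD mul_polyC actZ.
by rewrite -[_ * 'X]addr0 -[0 in LHS]polyC0 act_MXaddC mul0r addr0 IHp act_nbsum.
Qed.

Lemma actC (c : R) h t : act c%:P h t = c * h t.
Proof. by rewrite -[c%:P]add0r -[0](mul0r 'X) act_MXaddC act0 add0r. Qed.

Lemma act1 h : act 1 h = h.
Proof. by apply/funext => t; rewrite actC mul1r. Qed.

Lemma actX h : act 'X h = nbsum h.
Proof.
apply/funext => t; have := act_MXaddC 1 0 h t.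
by rewrite mul1r polyC0 addr0 act1 mul0r addr0.
Qed.

Lemma actXn n h : act 'X^n h = iter n nbsum h.
Proof. by elim: n => [|n IHn]; rewrite ?expr0 ?act1// exprS actM actX IHn. Qed.

(* The weight 2^i matches the sup norm of the i-th iterate of [nbsum]. *)
Definition wnorm p : R := \sum_(i < size p) `|p`_i| * 2 ^+ i.

Lemma wnormE n p : (size p <= n)%N -> wnorm p = \sum_(i < n) `|p`_i| * 2 ^+ i.
Proof.
move=> le_pn; rewrite /wnorm (big_ord_widen n (fun i => `|p`_i| * 2 ^+ i)) //.
rewrite big_mkcond; apply: eq_bigr => i _; case: ltnP => // le_pi.
by rewrite nth_default // normr0 mul0r.
Qed.

Lemma wnorm_ge0 p : 0 <= wnorm p.
Proof. by apply: sumr_ge0 => i _; rewrite mulr_ge0// exprn_ge0. Qed.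

Lemma wnorm0 : wnorm 0 = 0.
Proof. by rewrite /wnorm size_poly0 big_ord0. Qed.

Lemma wnorm_MXaddC p (c : R) : wnorm (p * 'X + c%:P) = 2 * wnorm p + `|c|.
Proof.
rewrite (@wnormE (size p).+1); last first.
  by rewrite size_MXaddC; case: ifP => // /andP[/eqP -> _].
rewrite big_ord_recl coefD coefMX eqxx coefC eqxx add0r expr0 mulr1 addrC.
rewrite /wnorm mulr_sumr; congr (_ + _).
by apply: eq_bigr => i _; rewrite coefD coefMX coefC /= addr0 exprS mulrCA.
Qed.

Lemma wnormMX p : wnorm (p * 'X) = 2 * wnorm p.
Proof. by rewrite -[_ * 'X]addr0 -[0 in LHS]polyC0 wnorm_MXaddC normr0 addr0. Qed.

Lemma wnormC (c : R) : wnorm c%:P = `|c|.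
Proof. by rewrite -[c%:P]add0r -[0](mul0r 'X) wnorm_MXaddC wnorm0 mulr0 add0r. Qed.

Lemma wnormD p q : wnorm (p + q) <= wnorm p + wnorm q.
Proof.
rewrite (@wnormE (maxn (size p) (size q))) ?size_polyD//.
rewrite !(@wnormE (maxn (size p) (size q))) ?leq_maxl ?leq_maxr// -big_split /=.
by apply: ler_sum => i _; rewrite coefD -mulrDl ler_wpM2r ?exprn_ge0 ?ler_normD.
Qed.

Lemma wnormZ (c : R) p : wnorm (c *: p) = `|c| * wnorm p.
Proof.
rewrite (@wnormE (size p)) ?size_scale_leq// /wnorm mulr_sumr.
by apply: eq_bigr => i _; rewrite coefZ normrM mulrA.
Qed.

Lemma wnormN p : wnorm (- p) = wnorm p.
Proof. by rewrite -scaleN1r wnormZ normrN1 mul1r. Qed.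

Lemma wnormB p q : wnorm (p - q) <= wnorm p + wnorm q.
Proof. by rewrite (le_trans (wnormD _ _))// wnormN. Qed.

Lemma wnormM p q : wnorm (p * q) <= wnorm p * wnorm q.
Proof.
elim/poly_ind: p => [|p c IHp]; first by rewrite mul0r wnorm0 mul0r.
rewrite wnorm_MXaddC [X in wnorm X]mulrDl mulrAC mul_polyC.
rewrite (le_trans (wnormD _ _))// wnormMX wnormZ [leRHS]mulrDl lerD//.
by rewrite -mulrA ler_wpM2l.
Qed.

Lemma wnormMXn n p : wnorm (p * 'X^n) = 2 ^+ n * wnorm p.
Proof.
elim: n => [|n IHn]; first by rewrite expr0 mulr1 mul1r.
by rewrite exprSr mulrA wnormMX IHn exprS mulrA.
Qed.

Lemma wnorm_take n p : wnorm (take_poly n p) <= wnorm p.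
Proof.
rewrite (@wnormE (maxn n (size p))).
  rewrite (@wnormE (maxn n (size p)) p) ?leq_maxr//.
  apply: ler_sum => i _; rewrite coef_take_poly; case: ifP => // _.
  by rewrite normr0 mul0r mulr_ge0 ?exprn_ge0.
by rewrite (leq_trans (size_take_poly _ _)) ?leq_maxl.
Qed.

Lemma iter_nbsum_le h (B : R) n t :
    (forall t', `|t' - t| <= n%:Z -> `|h t'| <= B) ->
  `|iter n nbsum h t| <= 2 ^+ n * B.
Proof.
elim: n t => [|n IHn] t hB; first by rewrite mul1r hB ?subrr.
rewrite iterS exprS -mulrA (_ : 2 * _ = 2 ^+ n * B + 2 ^+ n * B); last by ring.
by rewrite (le_trans (ler_normD _ _))// lerD// IHn// => t' ht; apply: hB; lia.
Qed.

Lemma act_le p h (B : R) n t : (size p <= n.+1)%N ->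
    (forall t', `|t' - t| <= n%:Z -> `|h t'| <= B) ->
  `|act p h t| <= wnorm p * B.
Proof.
move=> sz hB; rewrite /act (le_trans (ler_norm_sum _ _ _))// /wnorm mulr_suml.
apply: ler_sum => i _; rewrite normrM -mulrA ler_wpM2l// iter_nbsum_le// => t' ht.
by apply: hB; have := ltn_ord i; lia.
Qed.

End TwoSidedShift.

(** * Transfer of rows *)

Section Transfer.
Variable R : realType.
Implicit Types (p q : {poly R}) (g : nat -> int -> R).

(* Homogenized Chebyshev polynomials of the second kind: U_{n-1}(2/X) X^(n-1). *)
Fixpoint cheb n : {poly R} :=
  match n with
  | 0 => 0
  | n'.+1 => match n' with
             | 0 => 1
             | n''.+1 => 4%:P * cheb n' - 'X^2 * cheb n''
             end
  end.

Lemma chebSS n : cheb n.+2 = 4%:P * cheb n.+1 - 'X^2 * cheb n.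
Proof. by []. Qed.

Lemma nat_ind2 (P : nat -> Prop) :
  P 0%N -> P 1%N -> (forall n, P n -> P n.+1 -> P n.+2) -> forall n, P n.
Proof.
move=> P0 P1 PSS n; suff: P n /\ P n.+1 by case.
by elim: n => [//|n [Pn PSn]]; split => //; exact: PSS.
Qed.

Lemma size_cheb n : (size (cheb n) <= n)%N.
Proof.
elim/nat_ind2: n => [||n IH0 IH1]; rewrite ?size_poly0 ?size_poly1//.
rewrite chebSS (leq_trans (size_polyD _ _))// geq_max size_polyN; apply/andP; split.
  by rewrite mul_polyC (leq_trans (size_scale_leq _ _))// (leq_trans IH1).
by rewrite (leq_trans (size_polyMleq _ _))// size_polyXn !addSn /= !ltnS.
Qed.

Lemma wnorm_cheb n : wnorm (cheb n) <= 8 ^+ n.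
Proof.
elim/nat_ind2: n => [||n IH0 IH1].
- by rewrite wnorm0.
- by rewrite wnormC normr1; lra.
rewrite chebSS (le_trans (wnormB _ _))// mul_polyC wnormZ mulrC -[_ * cheb n]mulrC.
rewrite wnormMXn ger0_norm//; have : 0 <= (8 : R) ^+ n by rewrite exprn_ge0.
by rewrite !exprS in IH1 *; lra.
Qed.

Definition transfer g :=
  forall j t, nbsum (g j.+2) t + nbsum (g j) t = 4 * g j.+1 t.

Lemma act_chebSS p n h t :
  act (p * cheb n.+2) h t =
    4 * act (p * cheb n.+1) h t - act (p * 'X^2 * cheb n) h t.
Proof. by rewrite chebSS mulrBr actB mulrCA mul_polyC actZ mulrA. Qed.

Lemma act_transfer g p j t : transfer g ->
  act (p * 'X) (g j.+2) t = 4 * act p (g j.+1) t - act (p * 'X) (g j) t.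
Proof.
move=> hg; rewrite !actM !actX -act_scale.
have -> : (fun t => 4 * g j.+1 t) = (fun t => nbsum (g j.+2) t + nbsum (g j) t).
  by apply/funext => t'; rewrite hg.
by rewrite act_add addrK.
Qed.

(** The recursion only yields T g_{j+2}, and T has a kernel. Applying T^j clears every division, and
    both sides then obey the recursion of [cheb]. *)
Lemma transfer_initial g j t : transfer g ->
  act ('X^j) (g j.+1) t = act (cheb j.+1) (g 1%N) t - act ('X * cheb j) (g 0%N) t.
Proof.
move=> hg; elim/nat_ind2: j t => [t|t|j IH0 IH1 t].
- by rewrite mulr0 act0 subr0.
- rewrite -['X^1]mul1r act_transfer// mul1r mulr1 chebSS mulr0 subr0 mulr1.
  by rewrite actC act1.
rewrite exprSr act_transfer// IH1.
rewrite (_ : 'X^(j.+1) * 'X = 'X^2 * 'X^j); last by rewrite exprSr; ring.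
rewrite (actM 'X^2 'X^j) (_ : act ('X^j) (g j.+1) = fun t =>
  act (cheb j.+1) (g 1%N) t + (-1) * act ('X * cheb j) (g 0%N) t); last first.
  by apply/funext => t'; rewrite IH0 mulN1r.
rewrite act_add act_scale -!actM -[cheb j.+3]mul1r act_chebSS !mul1r.
rewrite act_chebSS.
rewrite (_ : 'X * 'X^2 * cheb j = 'X^2 * ('X * cheb j)); last by ring.
by ring.
Qed.

(** The boundary value problem between rows 0 and j + n, with denominators cleared. The case n = 1
    is an induction on j; both sides then obey the recursion of [cheb] in n. *)
Lemma transfer_dirichlet g j n t : transfer g ->
  act (cheb (j + n)) (g j) t =
    act ('X^n * cheb j) (g (j + n)%N) t + act ('X^j * cheb n) (g 0%N) t.
Proof.
move=> hg.
have adj i t' : act (cheb i.+1) (g i) t' =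
    act ('X * cheb i) (g i.+1) t' + act ('X^i) (g 0%N) t'.
  elim: i t' => [|i IH] t'; first by rewrite mulr0 act0 add0r.
  rewrite -[cheb i.+2]mul1r act_chebSS !mul1r.
  rewrite (mulrC 'X) act_transfer//.
  have -> : act (cheb i.+1 * 'X) (g i) t' = act 'X (act (cheb i.+1) (g i)) t'.
    by rewrite mulrC actM.
  have -> : act (cheb i.+1) (g i) =
      fun t => act ('X * cheb i) (g i.+1) t + act ('X^i) (g 0%N) t.
    by apply/funext.
  by rewrite act_add -!actM mulrA -expr2 -exprS; ring.
elim/nat_ind2: n t => [t|t|n IH0 IH1 t].
- by rewrite addn0 mulr0 act0 addr0 mul1r.
- by rewrite addn1 adj mulr1.
rewrite !addnS -[cheb (j + n).+2]mul1r act_chebSS !mul1r -addnS IH1 addnS (actM 'X^2 (cheb (j + n))).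
have -> : act (cheb (j + n)) (g j) = fun t =>
   act ('X^n * cheb j) (g (j + n)%N) t + act ('X^j * cheb n) (g 0%N) t.
  exact/funext.
rewrite act_add -!actM act_chebSS.
rewrite (_ : 'X^(n.+2) * cheb j = 'X^(n.+1) * cheb j * 'X); last by rewrite exprSr; ring.
rewrite act_transfer//.
rewrite (_ : 'X^(n.+1) * cheb j * 'X = 'X^2 * ('X^n * cheb j)); last by rewrite exprSr; ring.
rewrite (_ : 'X^2 * ('X^j * cheb n) = 'X^j * 'X^2 * cheb n); last by ring.
by ring.
Qed.

End Transfer.

(** * Inverting the Chebyshev polynomials modulo a power of X *)

Section Gap.
Variable R : realType.
Implicit Types (p q a b : {poly R}) (g : nat -> int -> R).

Lemma wnorm_geometric q K : wnorm q <= 2^-1 -> wnorm (\sum_(i < K) q ^+ i) <= 2.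
Proof.
move=> hq; suff : wnorm (\sum_(i < K) q ^+ i) <= 2 - 2 * 2^-1 ^+ K.
  by move=> /le_trans; apply; rewrite gerBl mulr_ge0// exprn_ge0// invr_ge0.
have hqn i : wnorm (q ^+ i) <= 2^-1 ^+ i.
  elim: i => [|i IH]; first by rewrite !expr0 wnormC normr1.
  by rewrite !exprS (le_trans (wnormM _ _))// ler_pM// wnorm_ge0.
elim: K => [|K IH]; first by rewrite big_ord0 wnorm0 expr0; lra.
rewrite big_ord_recr (le_trans (wnormD _ _))//.
by have := lerD IH (hqn K); move/le_trans; apply; rewrite exprS; lra.
Qed.

(* [rho] approximates the power series cheb m / cheb m.+1, which satisfies
   rho_{m+1} = 1 / (4 - X^2 rho_m). The bound 1/2 is the fixed point of this
   recursion at X = 2, so it propagates with no loss in m, and so does the norm of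
   the inverse [a], a product of such quotients. *)
Lemma cheb_inverse K m : exists a b,
  [/\ (size a <= K)%N, wnorm a <= 1 & a * cheb R m.+1 = 1 + b * 'X^K].
Proof.
suff [a [b [rho [c [*]]]]] : exists a b rho c,
    [/\ (size a <= K)%N, wnorm a <= 1, a * cheb R m.+1 = 1 + b * 'X^K,
        wnorm rho <= 2^-1 & rho * cheb R m.+1 = cheb R m + c * 'X^K].
  by exists a, b.
elim: m => [|m [a [b [rho [c [sa na ea nr er]]]]]].
  (* Truncating 1 keeps the size bound valid when K = 0. *)
  exists (take_poly K 1), (- drop_poly K 1), 0, 0; split.
  - exact: size_take_poly.
  - by rewrite (le_trans (wnorm_take _ _))// wnormC normr1.
  - by rewrite -[X in _ = X + _](poly_take_drop K) mulr1; ring.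
  - by rewrite wnorm0 invr_ge0.
  - by rewrite !mul0r addr0.
(* Since 4 - X^2 rho = 4 (1 - y) with [wnorm y] at most 1/2, the inverse is a geometric series cut
   after K terms; the error y^K is divisible by X^K. *)
pose y := 4^-1 *: ('X^2 * rho).
pose S := \sum_(i < K) y ^+ i.
pose rho' := 4^-1 *: S.
have ny : wnorm y <= 2^-1.
  by rewrite wnormZ (mulrC 'X^2) wnormMXn ger0_norm ?invr_ge0//; lra.
have nS := wnorm_geometric K ny.
have nrho' : wnorm rho' <= 2^-1.
  by rewrite wnormZ ger0_norm ?invr_ge0//; rewrite -/S in nS; lra.
have eS : rho' * (4%:P - 'X^2 * rho) = 1 - y ^+ K.
  have := subrX1 y K; rewrite -/S => e.
  have -> : 4%:P - 'X^2 * rho = 4%:P * (1 - y).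
    by rewrite /y mulrBr mulr1 -scalerAr mul_polyC scalerA mulVf ?scale1r ?pnatr_eq0.
  rewrite /rho' -mul_polyC.
  have e4 : (4^-1%:P : {poly R}) * 4%:P = 1 by rewrite -polyCM mulVf ?pnatr_eq0.
  rewrite (_ : 4^-1%:P * S * (4%:P * (1 - y)) = (4^-1%:P * 4%:P) * - ((y - 1) * S)); last by ring.
  by rewrite e4 -e; ring.
pose z := 4^-1 *: ('X * rho).
have yK : y ^+ K = z ^+ K * 'X^K.
  by rewrite -exprMn /y /z -scalerAl; congr ((_ *: _) ^+ _); ring.
have er' : rho' * cheb R m.+2 =
    cheb R m.+1 + (rho' * 'X^2 * c - z ^+ K * cheb R m.+1) * 'X^K.
  rewrite chebSS; have -> : cheb R m = rho * cheb R m.+1 - c * 'X^K by rewrite er; ring.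
  rewrite (_ : rho' * _ = rho' * (4%:P - 'X^2 * rho) * cheb R m.+1
    + rho' * 'X^2 * c * 'X^K).
    by rewrite eS yK; ring.
  by ring.
(* The next inverse is a rho', as rho' stands for the quotient of [cheb] at m + 1 by [cheb] at m +
   2. Truncation does not increase the norm, and its error goes into the multiple of X^K. *)
exists (take_poly K (a * rho')).
have := poly_take_drop K (a * rho'); set d := drop_poly _ _; set a' := take_poly _ _.
move=> /(canRL (addrK _)) ea'.
eexists _, rho', _; split; last exact: er'.
- exact: size_take_poly.
- rewrite (le_trans (wnorm_take _ _))// (le_trans (wnormM _ _))//.
  by rewrite (le_trans (ler_pM _ _ na nrho')) ?wnorm_ge0//; lra.
- rewrite ea' mulrBl -mulrA er' mulrDr ea.
  transitivity (1 + (b + a * (rho' * 'X^2 * c - z ^+ K * cheb R m.+1)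
     - d * cheb R m.+2) * 'X^K); first by ring.
  by [].
- exact: nrho'.
Qed.

Lemma size_mul_leqD p q m n :
  (size p <= m)%N -> (size q <= n)%N -> (size (p * q)%R <= m + n)%N.
Proof.
move=> hp hq; rewrite (leq_trans (size_polyMleq _ _))// (leq_trans (leq_pred _))//.
exact: leq_add.
Qed.

(* With a (cheb m) = 1 + b X^(j-1), row j is a (cheb m) g_j - b X^(j-1) g_j: the first
   term is given by rows 0 and m (Dirichlet formula), the second by rows 0 and 1. *)
Lemma gap_le g m j t (B : R) : transfer g -> (0 < j <= m)%N ->
    (forall i t', i \in [:: 0; 1; m]%N -> `|t' - t| <= (2 * m)%:Z -> `|g i t'| <= B) ->
  `|g j t| <= 6 * 64 ^+ m * B.
Proof.
move=> hg /andP[j0 jm] hB.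
have [K jK] : exists K, j = K.+1 by exists j.-1; rewrite prednK.
have [n mn] : exists n, m = (j + n)%N by exists (m - j)%N; rewrite subnKC.
have [a [b [sa na eab]]] := cheb_inverse K m.-1.
rewrite prednK in eab; last exact: leq_trans j0 jm.
have B0 : 0 <= B by apply: le_trans (hB 0%N t _ _); rewrite ?inE// subrr.
have gE : g j t = act (a * 'X^n * cheb R j) (g m) t + act (a * 'X^j * cheb R n) (g 0%N) t
   - act (b * cheb R j) (g 1%N) t + act (b * 'X * cheb R K) (g 0%N) t.
  have -> : g j t = act (a * cheb R m - b * 'X^K) (g j) t.
    by rewrite eab addrK act1.
  rewrite actB [in X in X - _]actM [in X in _ - X]actM jK.
  have -> : act ('X^K) (g K.+1) =
      fun t => act (cheb R K.+1) (g 1%N) t + (-1) * act ('X * cheb R K) (g 0%N) t.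
    by apply/funext => t'; rewrite transfer_initial// mulN1r.
  have -> : act (cheb R m) (g K.+1) =
      fun t => act ('X^n * cheb R j) (g m) t + act ('X^j * cheb R n) (g 0%N) t.
    by apply/funext => t'; rewrite -jK mn transfer_dirichlet.
  by rewrite !act_add act_scale -!actM !mulrA jK; ring.
have le8 i : (i <= m)%N -> (8 : R) ^+ i <= 8 ^+ m by move=> im; rewrite ler_eXn2l// ltr1n.
have sX i : (size ('X^i : {poly R}) <= i.+1)%N by rewrite size_polyXn.
(* The size and the norm of [b] are read off from this identity: multiplication by X^K raises the
   degree by K and does not decrease the norm. *)
have eb : b * 'X^K = a * cheb R m - 1 by rewrite eab; ring.
have sb : (size b <= m)%N.
  have [->|b0] := eqVneq b 0; first by rewrite size_poly0.
  have : (size (b * 'X^K)%R <= K + m)%N.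
    rewrite eb (leq_trans (size_polyD _ _))// geq_max size_polyN size_poly1.
    by rewrite size_mul_leqD ?size_cheb//= addn_gt0 (leq_trans j0 jm) orbT.
  by rewrite size_mulXn// leq_add2l.
have n8 i : 1 <= (8 : R) ^+ i by rewrite exprn_ege1// ler1n.
have nb : wnorm b <= 8 ^+ m + 1.
  have : wnorm (b * 'X^K) <= 8 ^+ m + 1.
    rewrite eb (le_trans (wnormB _ _))// lerD ?wnormC ?normr1//.
    rewrite (le_trans (wnormM _ _))// -[leRHS]mul1r ler_pM ?wnorm_ge0//.
    exact: wnorm_cheb.
  rewrite wnormMXn; apply: le_trans; rewrite -[leLHS]mul1r ler_wpM2r ?wnorm_ge0//.
  by rewrite exprn_ege1// ler1n.
have nc i : (i <= m)%N -> wnorm (cheb R i) <= 8 ^+ m.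
  by move=> im; rewrite (le_trans (wnorm_cheb _ _))// le8.
have nX i k : (i + k = m)%N -> wnorm (a * 'X^i * cheb R k) <= 8 ^+ m.
  move=> ik; rewrite (le_trans (wnormM _ _))// wnormMXn -ik exprD ler_pM//.
  - by rewrite mulr_ge0 ?exprn_ge0 ?wnorm_ge0.
  - exact: wnorm_ge0.
  - rewrite -[leRHS]mulr1 ler_pM ?exprn_ge0 ?wnorm_ge0//.
    by apply: lerXn2r; rewrite ?nnegrE ?ler0n// ler_nat.
  - exact: wnorm_cheb.
have n1 : wnorm (a * 'X^n * cheb R j) <= 8 ^+ m by apply: nX; lia.
have n2 : wnorm (a * 'X^j * cheb R n) <= 8 ^+ m by apply: nX; lia.
have n3 : wnorm (b * cheb R j) <= (8 ^+ m + 1) * 8 ^+ m.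
  by rewrite (le_trans (wnormM _ _))// ler_pM ?wnorm_ge0// nc.
have n4 : wnorm (b * 'X * cheb R K) <= (8 ^+ m + 1) * 8 ^+ m.
  rewrite (le_trans (wnormM _ _))// wnormMX.
  rewrite (_ : 2 * wnorm b * _ = wnorm b * (2 * wnorm (cheb R K))); last by ring.
  rewrite ler_pM ?wnorm_ge0 ?mulr_ge0 ?wnorm_ge0//.
  rewrite (@le_trans _ _ (8 ^+ K.+1))//; last by apply: le8; rewrite -jK.
  by rewrite exprS ler_pM ?wnorm_ge0 ?wnorm_cheb// ler_nat.
have bound p i : i \in [:: 0; 1; m]%N -> (size p <= (2 * m).+1)%N ->
    `|act p (g i) t| <= wnorm p * B.
  by move=> hi sp; apply: act_le sp _ => t'; exact: hB.
have in0 : 0%N \in [:: 0; 1; m]%N by [].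
have in1 : 1%N \in [:: 0; 1; m]%N by [].
have inm : m \in [:: 0; 1; m]%N by rewrite !inE eqxx !orbT.
rewrite gE (le_trans (ler_normD _ _))//.
have e64 : (64 : R) ^+ m = 8 ^+ m * 8 ^+ m by rewrite -exprMn -natrM.
set E := (8 : R) ^+ m in le8 n8 nb nc nX n1 n2 n3 n4 e64.
have E1 : 1 <= E by exact: n8.
have : `|act (a * 'X^n * cheb R j) (g m) t + act (a * 'X^j * cheb R n) (g 0%N) t
   - act (b * cheb R j) (g 1%N) t| <= E * B + E * B + (E + 1) * E * B.
  rewrite (le_trans (ler_normB _ _))// lerD//.
    rewrite (le_trans (ler_normD _ _))// lerD//.
      rewrite (le_trans (bound _ _ inm _)) ?ler_wpM2r//.
      apply: leq_trans (size_mul_leqD (size_mul_leqD sa (sX n)) (size_cheb R j)) _.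
      by clear -jK mn; lia.
    rewrite (le_trans (bound _ _ in0 _)) ?ler_wpM2r//.
    apply: leq_trans (size_mul_leqD (size_mul_leqD sa (sX j)) (size_cheb R n)) _.
    by clear -jK mn; lia.
  rewrite (le_trans (bound _ _ in1 _)) ?ler_wpM2r//.
  apply: leq_trans (size_mul_leqD sb (size_cheb R j)) _.
  by clear -jm; lia.
have : `|act (b * 'X * cheb R K) (g 0%N) t| <= (E + 1) * E * B.
  rewrite (le_trans (bound _ _ in0 _)) ?ler_wpM2r//.
  apply: leq_trans (size_mul_leqD (size_mul_leqD sb (sX 1%N)) (size_cheb R K)) _.
  by clear -jK mn; lia.
(* The four norms add up to 2 E + 2 (E + 1) E, at most 6 E^2 because E is at least 1. *)
move=> h1 h2; rewrite (le_trans (lerD h2 h1))// e64 -!mulrDl ler_wpM2r//.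
by nra.
Qed.

(** By [transfer_initial] this iterate combines rows 0 and 1 through polynomials of degree at most
    m, hence the window of radius m. *)
Lemma transfer_diff_le g m t (M : R) : transfer g ->
    (forall i t', (i < 2)%N -> `|t' - t| <= m%:Z -> `|g i t'| <= M) ->
  `|iter m (@nbsum R) (g m.+1) t| <= 2 * 8 ^+ m.+1 * M.
Proof.
move=> hg hM; rewrite -actXn transfer_initial// (le_trans (ler_normB _ _))//.
have M0 : 0 <= M by apply: le_trans (hM 0%N t _ _); rewrite ?subrr.
have h1 : `|act (cheb R m.+1) (g 1%N) t| <= 8 ^+ m.+1 * M.
  rewrite (le_trans (@act_le _ _ _ M m _ _ _)) ?size_cheb//; first by move=> t'; exact: hM.
  by rewrite ler_wpM2r// wnorm_cheb.
have h0 : `|act ('X * cheb R m) (g 0%N) t| <= 8 ^+ m.+1 * M.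
  rewrite (le_trans (@act_le _ _ _ M m _ _ _))//; last by rewrite ler_wpM2r//
     mulrC wnormMX exprS ler_pM ?wnorm_ge0 ?wnorm_cheb// ler_nat.
    by rewrite (leq_trans (size_polyMleq _ _))// size_polyX/= ltnS size_cheb.
  by move=> t'; exact: hM.
by have := lerD h1 h0; move/le_trans; apply; lra.
Qed.

End Gap.

(** * A discrete Remez inequality *)

Section Interpolation.

Definition ndist (m n : nat) : nat := (m - n + (n - m))%N.

(* Among k distinct integers different from z, the farthest one is at distance at least k/2. *)
Lemma fact_le_prod_ndist n (x : 'I_n -> nat) (A : {set 'I_n}) z : injective x ->
    (forall i, i \in A -> x i != z) ->
  ((#|A|)`! <= 2 ^ #|A| * \prod_(i in A) ndist z (x i))%N.
Proof.
move=> injx; move cA: #|A| => k; elim: k A cA => [|k IHk] A cA hA.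
  by rewrite big1// => i; rewrite (cards0_eq cA) inE.
have [i iA far] : exists2 i, i \in A & (k.+1 <= 2 * ndist z (x i))%N.
  apply/exists_inP; apply: contraT; rewrite negb_exists_in => /forall_inP near.
  (* Otherwise k + 2 distinct integers, z included, would lie in an interval of at most k + 1
     integers. *)
  have : (size (z :: [seq x i | i in A]) <= size (iota (z - k./2) (k./2 + k./2).+1))%N.
    apply: uniq_leq_size.
      rewrite /= map_inj_uniq// enum_uniq andbT.
      by apply/mapP => -[i]; rewrite mem_enum => /hA /[swap] <-; rewrite eqxx.
    move=> y; rewrite inE mem_iota => /orP[/eqP ->|/mapP[i]]; first by lia.
    by rewrite mem_enum => /near + -> {y}; rewrite /ndist -ltnNge; lia.
  by rewrite /= size_map -cardE cA size_iota; lia.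
have cAi : #|A :\ i| = k by move: cA; rewrite (cardsD1 i) iA => -[].
have hAi j : j \in A :\ i -> x j != z by rewrite !inE => /andP[_ /hA].
have := IHk _ cAi hAi.
rewrite factS expnS (big_setD1 i iA)/= => h.
by rewrite (leq_trans (leq_mul far h))// mulnACA.
Qed.

Lemma leq_bin_expn2 m i : ('C(m, i) <= 2 ^ m)%N.
Proof.
elim: m i => [|m IHm] [|i] //=; first by rewrite bin0 expn_gt0.
by rewrite binS expnS mul2n -addnn leq_add.
Qed.

(** L^k is at most (L + k) (L + k - 1) ... (L + 1) = k! C(L + k, k). *)
Lemma expn_le_fact L k : (L ^ k <= k`! * 2 ^ (L + k))%N.
Proof.
rewrite mulnC (@leq_trans ('C(L + k, k) * k`!)) ?leq_mul2r ?leq_bin_expn2 ?orbT//.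
rewrite bin_ffact; elim: k => [//|k IHk].
by rewrite addnS ffactnS expnS /= leq_mul//; lia.
Qed.

Variable R : realType.

Lemma natr_ndist m n : `|m%:R - n%:R| = (ndist m n)%:R :> R.
Proof.
rewrite /ndist natrD; have [le_mn|/ltnW le_nm] := leqP m n.
  rewrite (eqP le_mn) add0r natrB// distrC ger0_norm// subr_ge0 ler_nat//.
by rewrite (eqP le_nm) addr0 natrB// ger0_norm// subr_ge0 ler_nat.
Qed.

(** The spacing of the nodes is irrelevant: at X a Lagrange basis polynomial has numerator at most
    L^(n-1) and denominator at least (n-1)! / 2^(n-1), so its value is at most 8^L by
    [expn_le_fact], and there are n <= 2^L of them. *)
Lemma lagrange_bound (Q : {poly R}) (L : nat) (s : seq nat) (B : R) X :
    (size Q <= size s)%N -> uniq s -> all (fun y => y < L)%N s -> 0 <= B ->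
    {in s, forall y, `|Q.[y%:R]| <= B} -> (X < L)%N ->
  `|Q.[X%:R]| <= 16 ^+ L * B.
Proof.
move=> sQ us /allP sL B0 hQ XL.
have [s0|n_gt0] := posnP (size s).
  have -> : Q = 0 by apply/eqP; rewrite -size_poly_eq0 -leqn0 -s0.
  by rewrite horner0 normr0 mulr_ge0 ?exprn_ge0.
set n := size s in sQ n_gt0 *.
(* The interpolation formula takes an injective sequence on all naturals, so the nodes are continued
   by values at least L. *)
pose xn (j : nat) : nat := if (j < n)%N then nth 0%N s j else (L + j)%N.
have xn_inj : injective xn.
  move=> i j; rewrite /xn; case: ifP => hi; case: ifP => hj.
  - by move/eqP; rewrite nth_uniq// => /eqP.
  - by move=> e; have := sL _ (mem_nth 0%N hi) => /=; lia.
  - by move=> e; have := sL _ (mem_nth 0%N hj) => /=; lia.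
  - by move/addnI.
have xn_s (i : 'I_n) : xn i \in s by rewrite /xn ltn_ord mem_nth.
pose x (j : nat) : R := (xn j)%:R.
have x_inj : injective x by move=> i j /eqP; rewrite eqr_nat => /eqP/xn_inj.
rewrite (lagrange_gen n_gt0 x_inj sQ) horner_sum (le_trans (ler_norm_sum _ _ _))//.
have nL : (n <= L)%N.
  by rewrite -(size_iota 0 L) uniq_leq_size// => y /sL; rewrite mem_iota.
have -> : 16 ^+ L = 2 ^+ L * 8 ^+ L :> R by rewrite -exprMn -natrM.
have n2L : n%:R <= 2 ^+ L :> R.
  by rewrite -natrX ler_nat (leq_trans nL)// ltnW// ltn_expl.
apply: (@le_trans _ _ (n%:R * (8 ^+ L * B))); last first.
  by rewrite -mulrA ler_wpM2r// mulr_ge0 ?exprn_ge0.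
have -> : n%:R * (8 ^+ L * B) = \sum_(i < n) (8 ^+ L * B).
  by rewrite sumr_const card_ord mulr_natl.
apply: ler_sum => i _; rewrite hornerM hornerC normrM mulrC.
apply: ler_pM => //; last exact: hQ.
rewrite lagrangeE// hornerM hornerC normrM normfV !horner_prod !normr_prod.
pose A : {set 'I_n} := [set~ i]%SET.
have cA : #|A| = n.-1 by rewrite cardsC1 card_ord.
have hA j : j \in A -> xn j != xn i.
  by rewrite !inE; apply: contra => /eqP/xn_inj/ord_inj ->.
have xo_inj : injective (fun j : 'I_n => xn j) by move=> ? ? /xn_inj/ord_inj.
have := fact_le_prod_ndist xo_inj hA; rewrite cA => den.
have -> : \prod_(j < n | j != i) `|('X - (x j)%:P).[x i]| =
    (\prod_(j in A) ndist (xn i) (xn j))%:R.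
  rewrite natr_prod; apply: eq_big => [j|j _]; first by rewrite !inE.
  by rewrite !hornerE natr_ndist.
have num : \prod_(j < n | j != i) `|('X - (x j)%:P).[X%:R]| <= (L ^ n.-1)%:R :> R.
  rewrite -cA -prod_nat_const natr_prod.
  rewrite [leRHS](eq_bigl (fun j => j != i)) => [|j]; last by rewrite !inE.
  apply: ler_prod => j _; rewrite normr_ge0 !hornerE natr_ndist ler_nat.
  by have := sL _ (xn_s i); have := sL _ (xn_s j); rewrite /ndist /=; lia.
have Dpos : (0 < \prod_(j in A) ndist (xn i) (xn j))%N.
  by rewrite prodn_cond_gt0// => j /hA; rewrite /ndist; lia.
rewrite ler_pdivrMl ?ltr0n// (le_trans num)// -natrX -natrM ler_nat.
have k3 : (2 ^ n.-1 * 2 ^ (L + n.-1) <= 8 ^ L)%N.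
  by rewrite -expnD (_ : 8 = 2 ^ 3)%N// -expnM leq_exp2l//; lia.
rewrite (leq_trans (expn_le_fact _ _))// (leq_trans (leq_mul den (leqnn _)))//.
rewrite (_ : (_ * _ * _ = \prod_(j in A) ndist (xn i) (xn j)
    * (2 ^ n.-1 * 2 ^ (L + n.-1)))%N); last by ring.
by rewrite leq_mul2l k3 orbT.
Qed.

(** * Newton expansion and functions with small high differences *)

Definition fdiff (g : nat -> R) : nat -> R := fun i => g i.+1 - g i.

(** Newton's forward difference formula, by induction on x applied to the shifted function. Terms
    with i > x vanish, so N may be any bound of x. *)
Lemma newton_forward g x N : (x <= N)%N ->
  g x = \sum_(i < N.+1) iter i fdiff g 0%N * 'C(x, i)%:R.
Proof.
elim: x N g => [|x IHx] [|N] g // xN.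
- by rewrite big_ord1 mulr1.
- by rewrite big_ord_recl mulr1 big1 ?addr0// => i _; rewrite bin0n mulr0.
have sh i y : iter i fdiff (fun z => g z.+1) y = iter i fdiff g y.+1.
  by elim: i y => //= i IHi y; rewrite /fdiff !IHi.
rewrite -[LHS]/((fun z => g z.+1) x) (IHx N)// [RHS]big_ord_recl bin0 mulr1 /=.
have d1 i : iter i fdiff g 1%N = iter i fdiff g 0%N + iter i.+1 fdiff g 0%N.
  by rewrite iterS /fdiff addrC subrK.
under eq_bigr => i _ do rewrite sh d1 mulrDl.
rewrite big_split /=.
under [in RHS]eq_bigr => i _ do rewrite /bump /= add1n binS natrD mulrDr.
rewrite big_split /= addrA; congr (_ + _).
have := @big_ord_recl R 0 +%R N.+1 (fun i => iter i fdiff g 0%N * 'C(x, i)%:R).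
rewrite big_ord_recr /= bin_small// mulr0 addr0 bin0 mulr1 => ->.
by congr (_ + _); apply: eq_bigr => i _; rewrite /bump.
Qed.

Lemma iter_fdiff_le g (B : R) i n : (forall k, (k <= n)%N -> `|g (i + k)%N| <= B) ->
  `|iter n fdiff g i| <= 2 ^+ n * B.
Proof.
elim: n i => [|n IHn] i hg; first by rewrite mul1r -[i]addn0 hg.
rewrite iterS /fdiff exprS -mulrA (_ : 2 * _ = 2 ^+ n * B + 2 ^+ n * B); last by ring.
rewrite (le_trans (ler_normB _ _))// lerD// IHn// => k kn; last by rewrite hg// leqW.
by rewrite addSnnS hg.
Qed.

(** The binomial coefficient C(X, i) as a polynomial in X. *)
Definition binpoly i : {poly R} := i`!%:R^-1 *: \prod_(k < i) ('X - k%:R%:P).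

Lemma size_binpoly i : (size (binpoly i) <= i.+1)%N.
Proof.
rewrite (leq_trans (size_scale_leq _ _))// size_prod => [|k _]; last first.
  by rewrite polyXsubC_eq0.
rewrite (eq_bigr (fun=> 2%N)) => [|k _]; last by rewrite size_XsubC.
by rewrite sum_nat_const card_ord; lia.
Qed.

Lemma horner_binpoly i x : (binpoly i).[x%:R] = 'C(x, i)%:R.
Proof.
rewrite hornerZ horner_prod.
have -> : \prod_(k < i) ('X - k%:R%:P).[x%:R] = (x ^_ i)%:R :> R.
  elim: i => [|i IH]; first by rewrite big_ord0 ffactn0.
  rewrite big_ord_recr /= IH ffactnSr natrM !hornerE.
  have [le_ix|lt_xi] := leqP i x; first by rewrite natrB.
  by rewrite ffact_small// !mul0r.
by rewrite -bin_ffact natrM mulrC mulfK// pnatr_eq0 -lt0n fact_gt0.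
Qed.

(** Cut the Newton expansion at order n: the first n terms form a polynomial of degree < n, and the
    tail is at most 8^L B. The polynomial is thus bounded by 16^L B on [s], and [lagrange_bound]
    carries this to all x < L. *)
Lemma fdiff_remez g (L n : nat) (s : seq nat) (B : R) x : 0 <= B ->
    (forall i, (i + n < L)%N -> `|iter n fdiff g i| <= B) ->
    uniq s -> all (fun y => y < L)%N s -> (n <= size s)%N ->
    {in s, forall y, `|g y| <= B} -> (x < L)%N ->
  `|g x| <= 512 ^+ L * B.
Proof.
move=> B0 hn us sL ns hs xL.
pose Q := \sum_(i < n) iter i fdiff g 0%N *: binpoly i.
have gQ y : (y < L)%N -> `|g y - Q.[y%:R]| <= 8 ^+ L * B.
  move=> yL; rewrite (@newton_forward g y (n + L)); last by lia.
  rewrite -addnS big_split_ord /= horner_sum.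
  rewrite (eq_bigr (fun i : 'I_n => (iter i fdiff g 0%N *: binpoly i).[y%:R])); last first.
    by move=> i _; rewrite hornerZ horner_binpoly.
  rewrite [X in `|X|]addrC addKr (le_trans (ler_norm_sum _ _ _))//.
  apply: (@le_trans _ _ (\sum_(i < L.+1) (4 ^+ L * B))); last first.
    rewrite sumr_const card_ord -mulrnAl ler_wpM2r// -mulr_natr.
    have -> : 8 ^+ L = 4 ^+ L * 2 ^+ L :> R by rewrite -exprMn -natrM.
    by rewrite ler_wpM2l ?exprn_ge0// -natrX ler_nat ltn_expl.
  apply: ler_sum => i _.
  (* A tail term survives only if n + i <= y < L; then the bound on n-th differences holds at all
     points that the i further differences involve. *)
  have [ltyi|leiy] := ltnP y (n + i).
    by rewrite bin_small// mulr0 normr0 mulr_ge0// exprn_ge0.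
  rewrite normrM addnC iterD mulrC normr_nat.
  have -> : 4 ^+ L = 2 ^+ L * 2 ^+ L :> R by rewrite -exprMn -natrM.
  rewrite -mulrA ler_pM//.
    rewrite -natrX ler_nat (leq_trans (leq_bin_expn2 _ _))//.
    by rewrite leq_exp2l// ltnW.
  rewrite (le_trans (@iter_fdiff_le _ B _ _ _))// => [k ki|].
    by rewrite add0n hn//; lia.
  by rewrite ler_wpM2r// ler_eXn2l ?ltr1n//; lia.
have hQ : {in s, forall y, `|Q.[y%:R]| <= 16 ^+ L * B}.
  move=> y ys; have yL := allP sL _ ys.
  have -> : Q.[y%:R] = g y - (g y - Q.[y%:R]) by ring.
  rewrite (le_trans (ler_normB _ _))// (le_trans (lerD (hs _ ys) (gQ _ yL)))//.
  rewrite -[X in X + _]mul1r -mulrDl ler_wpM2r//.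
  have -> : 16 ^+ L = 8 ^+ L * 2 ^+ L :> R by rewrite -exprMn -natrM.
  have : 1 <= 8 ^+ L :> R by rewrite exprn_ege1// ler1n.
  have : 2 <= 2 ^+ L :> R by rewrite -[leLHS]expr1 ler_eXn2l ?ltr1n//; lia.
  by nra.
have sQ : (size Q <= size s)%N.
  rewrite (leq_trans _ ns)// (leq_trans (size_sum _ _ _))//.
  apply/bigmax_leqP => i _; rewrite (leq_trans (size_scale_leq _ _))//.
  by rewrite (leq_trans (size_binpoly _)).
have QX := lagrange_bound sQ us sL (mulr_ge0 (exprn_ge0 L (ler0n R 16)) B0) hQ xL.
have -> : g x = Q.[x%:R] + (g x - Q.[x%:R]) by ring.
rewrite (le_trans (ler_normD _ _))// (le_trans (lerD QX (gQ _ xL)))//.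
rewrite mulrA -mulrDl ler_wpM2r// -exprMn -natrM.
have -> : 512 ^+ L = 256 ^+ L * 2 ^+ L :> R by rewrite -exprMn -natrM.
have : 8 ^+ L <= 256 ^+ L :> R by apply: lerXn2r; rewrite ?nnegrE ?ler0n// ler_nat.
have : 2 <= 2 ^+ L :> R by rewrite -[leLHS]expr1 ler_eXn2l ?ltr1n//; lia.
have : 0 <= 8 ^+ L :> R by rewrite exprn_ge0.
by rewrite (_ : 16 * 16 = 256)%N//; nra.
Qed.

End Interpolation.

(** * Extension of bounds across rows *)

Section Extension.
Variable R : realType.
Implicit Types (h : int -> R) (g : nat -> int -> R) (B M : R).

Definition rowbad B h (t : int) (k : nat) : nat :=
  count (fun i : nat => B < `|h (t + i%:Z)|) (iota 0 k).

Lemma rowbad_anti B B' h t k : B <= B' -> (rowbad B' h t k <= rowbad B h t k)%N.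
Proof. by move=> BB; apply: sub_count => i /=; exact: le_lt_trans. Qed.

Lemma rowbad_interior B h t1 (w k : nat) : (2 * k <= w)%N ->
    (forall t, k%:Z <= t - t1 <= w%:Z - k%:Z -> `|h t| <= B) ->
  (rowbad B h t1 w.+1 <= 2 * k)%N.
Proof.
move=> kw inner; rewrite /rowbad.
have -> : (w.+1 = k + (w.+1 - 2 * k) + k)%N by lia.
rewrite !iotaD !count_cat (@eq_in_count _ _ pred0 (iota (0 + k) _)); last first.
  by move=> i; rewrite mem_iota => hi; apply/negbTE; rewrite -leNgt inner//; lia.
rewrite count_pred0 addn0 mul2n -addnn leq_add//.
  by rewrite (leq_trans (count_size _ _))// size_iota.
by rewrite (leq_trans (count_size _ _))// size_iota.
Qed.

(** With alternating signs, a difference of step 2 becomes the sum of two values at distance 2, that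
    is, [nbsum] at their midpoint. *)
Lemma iter_fdiff_sign h t n i :
  iter n (@fdiff R) (fun i => (-1) ^+ i * h (t + (2 * i)%:Z)) i =
  (-1) ^+ (i + n) * iter n (@nbsum R) h (t + (2 * i + n)%:Z).
Proof.
elim: n i => [|n IHn] i; first by rewrite !addn0.
rewrite !iterS {1}/fdiff !IHn /nbsum addSnnS addnS exprS.
have -> : t + (2 * i.+1 + n)%:Z = t + (2 * i + n.+1)%:Z + 1 by lia.
have -> : t + (2 * i + n)%:Z = t + (2 * i + n.+1)%:Z - 1 by lia.
by ring.
Qed.

(* [nbsum] couples points of equal parity only, where it is a forward difference up to signs. *)
Lemma window_remez h t1 (w n : nat) B t : 0 <= B -> (2 <= w)%N -> (16 * n <= w)%N ->
    (forall t, n%:Z <= t - t1 <= w%:Z - n%:Z -> `|iter n (@nbsum R) h t| <= B) ->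
    (4 * rowbad B h t1 w.+1 <= w)%N -> 0 <= t - t1 <= w%:Z ->
  `|h t| <= 512 ^+ w * B.
Proof.
move=> B0 w2 nw hn bad tw.
have [k kE] : exists k : nat, t = t1 + k%:Z by exists `|t - t1|%N; lia.
have kw : (k <= w)%N by lia.
pose e : nat := odd k; pose x := k./2.
have kex : k = (e + 2 * x)%N by rewrite -[LHS]odd_double_half mul2n.
have ew : (e <= 1)%N by exact: leq_b1.
pose L := ((w - e)./2).+1.
pose g i : R := (-1) ^+ i * h (t1 + e%:Z + (2 * i)%:Z).
have ng i : `|g i| = `|h (t1 + e%:Z + (2 * i)%:Z)|.
  by rewrite /g normrM normrX normrN1 expr1n mul1r.
pose p (i : nat) := `|g i| <= B.
have cL : (count (predC p) (iota 0 L) <= rowbad B h t1 w.+1)%N.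
  rewrite /rowbad -!size_filter -(size_map (fun i => e + 2 * i)%N).
  apply: uniq_leq_size.
    by rewrite map_inj_uniq ?filter_uniq ?iota_uniq// => ? ?; lia.
  move=> y /mapP[i]; rewrite mem_filter mem_iota => /andP[hi iL] ->.
  have {}hi : B < `|h (t1 + e%:Z + (2 * i)%:Z)| by rewrite -ng ltNge.
  rewrite mem_filter mem_iota PoszD addrA hi /=; move: iL; rewrite /L; lia.
(* The parity class has at least w/2 points and at most w/4 bad ones, leaving at least w/4, hence at
   least n. *)
have sz : (n <= size [seq i <- iota 0 L | p i])%N.
  have := count_predC p (iota 0 L); rewrite size_iota size_filter.
  have LE : (w <= 2 * L)%N by rewrite /L; lia.
  by move: (count p _) (count (predC p) _) (rowbad _ _ _ _) cL bad => c1 c2 c3; lia.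
have -> : `|h t| = `|g x| by rewrite ng kE kex PoszD addrA.
have : `|g x| <= 512 ^+ L * B.
  apply: (@fdiff_remez R g L n [seq i <- iota 0 L | p i]) => //.
  - move=> i iL; rewrite /g iter_fdiff_sign normrM normrX normrN1 expr1n mul1r hn//.
    by move: iL; rewrite /L; lia.
  - by rewrite filter_uniq ?iota_uniq.
  - by apply/allP => y; rewrite mem_filter mem_iota => /andP[].
  - by move=> y; rewrite mem_filter => /andP[].
  - by move: kw; rewrite kex /L; lia.
move/le_trans; apply; rewrite ler_wpM2r// ler_eXn2l ?ltr1n// /L; lia.
Qed.

(** Row m comes first: it has few bad points and T^(m-1) of it is controlled, so the Remez bound
    applies. Then [gap_le] bounds row j away from the ends of the window, and a second Remez step
    reaches the ends. *)
Lemma hop_le g t1 (w m : nat) M j t : transfer g -> 1 <= M -> (2 <= m)%N ->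
    (16 * m <= w)%N ->
    (forall i t, (i < 2)%N -> 0 <= t - t1 <= w%:Z -> `|g i t| <= M) ->
    (8 * rowbad 1 (g m) t1 w.+1 <= w)%N ->
    (j <= m)%N -> 0 <= t - t1 <= w%:Z ->
  `|g j t| <= 2 ^+ (31 * w) * M.
Proof.
move=> hg M1 m2 mw hM bad jm tw.
have M0 : 0 <= M by rewrite (le_trans _ M1).
have e1 (c : R) k : 1 <= c -> 1 <= c ^+ k by exact: exprn_ege1.
have [j2|j2] := ltnP j 2.
  by rewrite (le_trans (hM j t j2 tw))// -[leLHS]mul1r ler_wpM2r// e1// ler1n.
pose B0 := 2 * 8 ^+ m * M.
have diff i t' : (2 <= i <= m)%N -> i.-1%:Z <= t' - t1 <= w%:Z - i.-1%:Z ->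
    `|iter i.-1 (@nbsum R) (g i) t'| <= B0.
  move=> im ht; have -> : g i = g i.-1.+1 by congr g; clear -im; lia.
  apply: le_trans (@transfer_diff_le R g i.-1 t' M hg _) _.
    by move=> k t'' k2 ht'; apply: hM => //; clear -ht ht'; lia.
  by rewrite ler_wpM2r// ler_wpM2l// ler_eXn2l ?ltr1n//; clear -im; lia.
have w2 : (2 <= w)%N by clear -m2 mw; lia.
have B0ge : M <= B0.
  by rewrite -[leLHS]mul1r ler_wpM2r//; have := e1 8 m; rewrite ler1n => /(_ isT); lra.
have B00 : 0 <= B0 by rewrite (le_trans M0).
pose B1 := 512 ^+ w * B0.
have B1ge : B0 <= B1 by rewrite -[leLHS]mul1r ler_wpM2r// e1// ler1n.
have hm t' : 0 <= t' - t1 <= w%:Z -> `|g m t'| <= B1.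
  move=> ht; apply: (@window_remez (g m) t1 w m.-1) => //.
  - by clear -mw; lia.
  - by move=> t'' ht'; apply: diff => //; rewrite m2 leqnn.
  - have := rowbad_anti (g m) t1 w.+1 (le_trans M1 B0ge).
    by move: (rowbad _ _ _ _) (rowbad _ _ _ _) bad; clear; lia.
pose B2 := 6 * 64 ^+ m * B1.
have B12 : B1 <= B2.
  rewrite -[leLHS]mul1r ler_wpM2r ?(le_trans B00)//.
  by have := e1 64 m; rewrite ler1n => /(_ isT); lra.
have MB1 : M <= B1 by exact: le_trans B1ge.
have inner t' : (2 * m)%:Z <= t' - t1 <= w%:Z - (2 * m)%:Z -> `|g j t'| <= B2.
  move=> ht; apply: gap_le => //; first by rewrite jm (ltn_trans _ j2).
  have inw t'' : `|t'' - t'| <= (2 * m)%:Z -> 0 <= t'' - t1 <= w%:Z.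
    by clear -ht; lia.
  move=> i t''; rewrite !inE => /or3P[] /eqP-> /inw ht'; last exact: hm.
  - exact: le_trans (hM 0%N _ _ _) MB1.
  - exact: le_trans (hM 1%N _ _ _) MB1.
have B2_0 : 0 <= B2 by rewrite (le_trans B00)// (le_trans B1ge).
have : `|g j t| <= 512 ^+ w * B2.
  apply: (@window_remez (g j) t1 w j.-1) => //.
  - by clear -mw jm; lia.
  - move=> t' ht; rewrite (le_trans (diff _ _ _ ht)) ?j2//.
    exact: le_trans B12.
  (* Only the 2 m points at either end can be large; since 16 m <= w, these 4 m points meet the
     quarter allowed by [window_remez]. *)
  - have m2w : (2 * (2 * m) <= w)%N by clear -mw; lia.
    by have := rowbad_interior m2w inner; clear -mw; lia.
move/le_trans; apply; rewrite /B2 /B1 /B0.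
have -> : 512 ^+ w * (6 * 64 ^+ m * (512 ^+ w * (2 * 8 ^+ m * M))) =
  512 ^+ w * 512 ^+ w * 12 * (64 ^+ m * 8 ^+ m) * M by ring.
rewrite ler_wpM2r// exprM.
have -> : 2 ^+ 31 = 512 * (512 * (16 * (64 * 8))) :> R by ring.
rewrite !exprMn -!mulrA.
have pos (c : R) k : 0 <= c -> 0 <= c ^+ k by exact: exprn_ge0.
apply: ler_wpM2l; first exact/pos/ler0n.
apply: ler_wpM2l; first exact/pos/ler0n.
have mono (c : R) : 1 <= c -> c ^+ m <= c ^+ w.
  by move=> c1; apply: ler_weXn2l => //; clear -mw; lia.
apply: ler_pM; rewrite ?mulr_ge0 ?pos ?ler0n//; last first.
  by apply: ler_pM; rewrite ?pos ?ler0n// mono// ler1n.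
apply: (@le_trans _ _ (16 ^+ 1)); first by rewrite expr1 ler_nat.
by apply: ler_weXn2l; [rewrite ler1n|clear -w2; lia].
Qed.

(** Induction on n: each hop costs a factor 2^(31 w) and advances the pair of consecutive controlled
    rows by r. *)
Lemma extend_le g t1 (w r n : nat) M j t : transfer g -> 1 <= M -> (1 <= r)%N ->
    (32 * r <= w)%N ->
    (forall i t, (i < 2)%N -> 0 <= t - t1 <= w%:Z -> `|g i t| <= M) ->
    (8 * \sum_(0 <= i < (n.+1 * r).+1) rowbad 1 (g i) t1 w.+1 < r * w)%N ->
    (j <= (n * r).+1)%N -> 0 <= t - t1 <= w%:Z ->
  `|g j t| <= 2 ^+ (31 * w * n) * M.
Proof.
move=> hg M1 r1 rw hM; have M0 : 0 <= M by rewrite (le_trans _ M1).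
elim: n j t => [|n IHn] j t bad jn tw.
  by rewrite muln0 mul1r hM//; lia.
have splitsum : (\sum_(0 <= i < (n.+2 * r).+1) rowbad 1 (g i) t1 w.+1 =
    \sum_(0 <= i < (n.+1 * r).+1) rowbad 1 (g i) t1 w.+1 +
    \sum_((n.+1 * r).+1 <= i < (n.+2 * r).+1) rowbad 1 (g i) t1 w.+1)%N.
  by rewrite (@big_cat_nat _ _ _ (n.+1 * r).+1)// ltnS; clear; lia.
have {}IHn j' t' : (j' <= (n * r).+1)%N -> 0 <= t' - t1 <= w%:Z ->
    `|g j' t'| <= 2 ^+ (31 * w * n) * M.
  by apply: IHn; move: bad; rewrite splitsum; lia.
have [jn'|jn'] := leqP j (n * r).+1.
  rewrite (le_trans (IHn _ _ jn' tw))// ler_wpM2r// ler_eXn2l ?ltr1n//; lia.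
(* If each of the next r rows had more than w/8 bad points, the total would exceed the budget. As m
   > r, the hop covers row (n + 1) r + 1, the second of the pair that starts the next hop. *)
have [m /andP[m1 m2] good] : exists2 m, (r < m <= 2 * r)%N &
    (8 * rowbad 1 (g (n * r + m)%N) t1 w.+1 <= w)%N.
  apply: contrapT => none.
  have : (\sum_((n.+1 * r).+1 <= i < (n.+2 * r).+1) w.+1 <=
      8 * \sum_((n.+1 * r).+1 <= i < (n.+2 * r).+1) rowbad 1 (g i) t1 w.+1)%N.
    rewrite big_distrr /= big_nat [leqRHS]big_nat; apply: leq_sum => i hi.
    rewrite ltnNge; apply/negP => le_w; apply: none.
    by exists (i - n * r)%N; [lia | rewrite subnKC//; lia].
  by rewrite sum_nat_const_nat; move: bad; rewrite splitsum; nia.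
have -> : j = (n * r + (j - n * r))%N by lia.
rewrite mulnS exprD -mulrA.
apply: (@hop_le (fun i => g (n * r + i)%N) t1 w m _ (j - n * r)) => //.
- by move=> i t'; rewrite !addnS hg.
- by rewrite -[leLHS]mulr1 ler_pM// exprn_ege1// ler1n.
- by lia.
- by lia.
- by move=> i t' i2 ht; rewrite IHn//; lia.
- by move: jn; lia.
Qed.

End Extension.

(** * Dyadic induction on tilted squares *)

Section TiltedSquares.
Variable R : realType.
Implicit Types (f : int -> int -> R) (a b : int) (M : R).

(** Harmonicity in the coordinates s = n + m, t = n - m: lattice neighbours become diagonal ones. *)
Definition tilted_harmonic f := forall s t,
  f (s + 1) (t + 1) + f (s + 1) (t - 1) + f (s - 1) (t + 1) + f (s - 1) (t - 1)
  = 4 * f s t.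

Definition swap f : int -> int -> R := fun s t => f t s.

Lemma tilted_swap f : tilted_harmonic f -> tilted_harmonic (swap f).
Proof. by move=> hf s t; rewrite /swap -hf; ring. Qed.

Lemma tilted_transfer_up f a : tilted_harmonic f ->
  transfer (fun i : nat => f (a + i%:Z)).
Proof.
move=> hf i t; rewrite /nbsum -hf.
have -> : a + i.+1%:Z + 1 = a + i.+2%:Z by lia.
have -> : a + i.+1%:Z - 1 = a + i%:Z by lia.
by ring.
Qed.

Lemma tilted_transfer_down f a : tilted_harmonic f ->
  transfer (fun i : nat => f (a - i%:Z)).
Proof.
move=> hf i t; rewrite /nbsum -hf.
have -> : a - i.+1%:Z + 1 = a - i%:Z by lia.
have -> : a - i.+1%:Z - 1 = a - i.+2%:Z by lia.
by ring.
Qed.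

Definition sqbad f a b (l k : nat) : nat :=
  (\sum_(0 <= i < l) rowbad 1%R (f (a + i%:Z)%R) b k)%N.

Lemma rowbadD B (h : int -> R) t k k' :
  rowbad B h t (k + k') = (rowbad B h t k + rowbad B h (t + k%:Z)%R k')%N.
Proof.
rewrite /rowbad iotaD count_cat add0n -{1}[k in iota k k']addn0 iotaDl count_map.
by congr addn; apply: eq_count => i /=; rewrite PoszD addrA.
Qed.

Lemma rowbad_sub B (h : int -> R) t (y k' k : nat) : (y + k' <= k)%N ->
  (rowbad B h (t + y%:Z) k' <= rowbad B h t k)%N.
Proof.
by move=> /subnK <-; rewrite addnC !rowbadD; lia.
Qed.

Lemma sqbad_rows f a b l l' k :
  sqbad f a b (l + l') k = (sqbad f a b l k + sqbad f (a + l%:Z)%R b l' k)%N.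
Proof.
rewrite /sqbad (@big_cat_nat _ _ _ l)//= ?leq_addr//; congr addn.
rewrite -{1}[l]add0n big_addn addnC addnK.
by apply: eq_big_nat => i _; rewrite addnC PoszD addrA.
Qed.

Lemma sqbad_swap f a b l k : sqbad (swap f) b a k l = sqbad f a b l k.
Proof.
have rowbadE h t n : rowbad 1%R h t n = (\sum_(0 <= i < n) (1 < `|h (t + i%:Z)|)%R : nat)%N.
  by rewrite /rowbad -sum1_count big_mkcond /index_iota subn0; apply: eq_bigr => i _; case: ifP.
rewrite /sqbad; under eq_bigr do rewrite rowbadE.
by under [RHS]eq_bigr do rewrite rowbadE; rewrite exchange_big_nat.
Qed.

Lemma sqbad_cols f a b l k k' :
  sqbad f a b l (k + k') = (sqbad f a b l k + sqbad f a (b + k%:Z)%R l k')%N.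
Proof. by rewrite -!(sqbad_swap f) sqbad_rows. Qed.

Lemma sqbad_subrows f a b l k (x n y k' : nat) : (x + n <= l)%N -> (y + k' <= k)%N ->
  (\sum_(0 <= i < n) rowbad 1%R (f (a + x%:Z + i%:Z)%R) (b + y%:Z)%R k' <= sqbad f a b l k)%N.
Proof.
move=> xn yk.
have -> : l = (x + n + (l - (x + n)))%N by lia.
rewrite !sqbad_rows.
apply: (@leq_trans (sqbad f (a + x%:Z) b n k)); last by lia.
by apply: leq_sum => i _; exact: rowbad_sub.
Qed.

(** Pigeonhole over the four quarters; the booleans, read as 0 or 1, select a half in each
    coordinate. *)
Lemma sqbad_quarter f a b (n m : nat) : (sqbad f a b (n + n) (n + n) < 4 * m)%N ->
  exists c1 c2 : bool,
    (sqbad f (a + (c1 * n)%N%:Z) (b + (c2 * n)%N%:Z) n n < m)%N.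
Proof.
rewrite sqbad_rows !sqbad_cols => bad; apply: contrapT => none.
have ge (c1 c2 : bool) :
    (m <= sqbad f (a + (c1 * n)%N%:Z) (b + (c2 * n)%N%:Z) n n)%N.
  by rewrite leqNgt; apply/negP => lt; apply: none; exists c1, c2.
have := ge false false; have := ge false true; have := ge true false; have := ge true true.
rewrite !mul0n !mul1n !addr0; move: bad.
by move: (sqbad f a b n n) (sqbad f _ b n n) (sqbad f a _ n n) (sqbad f _ _ n n); clear; lia.
Qed.

(** A bound near row 32 r is carried upwards, or near row 96 r downwards when [c] is true, over the
    middle half of a square of side 128 r in 64 hops of r rows. The three rows in the hypothesis
    serve both directions. *)
Lemma stretch_le f a b (r y w : nat) (c : bool) M : tilted_harmonic f -> 1 <= M ->
    (1 <= r)%N -> (32 * r <= w)%N -> (y + w < 128 * r)%N ->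
    (8 * sqbad f a b (128 * r) (128 * r) < r * w)%N ->
    (forall i j : nat, (32 * r + c * (64 * r) <= i.+1)%N ->
       (i <= (32 * r + c * (64 * r)).+1)%N -> (y <= j <= y + w)%N ->
       `|f (a + i%:Z) (b + j%:Z)| <= M) ->
  forall i j : nat, (32 * r <= i <= 96 * r)%N -> (y <= j <= y + w)%N ->
    `|f (a + i%:Z) (b + j%:Z)| <= 2 ^+ (31 * w * 64) * M.
Proof.
move=> hf M1 r1 rw yw bad hM i j hi hj.
have win t : 0 <= t - (b + y%:Z) <= w%:Z ->
    exists2 j' : nat, (y <= j' <= y + w)%N & t = b + j'%:Z.
  by move=> ht; exists `|t - b|%N; clear -ht; lia.
have tw : 0 <= b + j%:Z - (b + y%:Z) <= w%:Z by clear -hj; lia.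
have yk : (y + w.+1 <= 128 * r)%N by clear -yw; lia.
case: c hM => hM.
  have -> : a + i%:Z = a + (96 * r)%:Z - (96 * r - i)%:Z by clear -hi; lia.
  apply: (@extend_le _ _ (b + y%:Z) w r 64 M (96 * r - i) _ (tilted_transfer_down _ hf)) => //.
  - move=> i' t i2 /win[j' hj' ->].
    have -> : a + (96 * r)%:Z - i'%:Z = a + (96 * r - i')%:Z by clear -i2 r1; lia.
    by apply: hM => //; clear -i2 r1; lia.
  - apply: leq_ltn_trans bad; rewrite leq_mul2l /=.
    (* The sum visits rows 96 r down to 31 r; reversing it gives an increasing block of rows. *)
    rewrite big_nat_rev /= add0n.
    rewrite (@eq_big_nat _ _ _ _ _ _ (fun i' =>
      rowbad 1%R (f (a + (31 * r)%:Z + i'%:Z)) (b + y%:Z)%R w.+1)); last first.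
      move=> i' hi'; congr (rowbad _ (f _) _ _).
      by clear -hi'; lia.
    by apply: sqbad_subrows => //; clear -r1; lia.
  - by clear -hi; lia.
have -> : a + i%:Z = a + (32 * r)%:Z + (i - 32 * r)%:Z by clear -hi; lia.
apply: (@extend_le _ _ (b + y%:Z) w r 64 M (i - 32 * r) _ (tilted_transfer_up _ hf)) => //.
- move=> i' t i2 /win[j' hj' ->]; rewrite -addrA -PoszD.
  by apply: hM => //; clear -i2; lia.
- apply: leq_ltn_trans bad; rewrite leq_mul2l /=.
  by apply: sqbad_subrows => //; clear -r1; lia.
- by clear -hi; lia.
Qed.

(* If the square has few bad points, so has one of its four quarters; the bound on
   the middle of that quarter is stretched first in s, then in t. The factors lost at
   successive scales form a geometric series, hence the exponent linear in the side. *)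
Lemma square_le k f a b : tilted_harmonic f ->
    (sqbad f a b (64 * 2 ^ k) (64 * 2 ^ k) < 2 ^ k * 2 ^ k)%N ->
  forall i j : nat, (16 * 2 ^ k <= i <= 48 * 2 ^ k)%N ->
    (16 * 2 ^ k <= j <= 48 * 2 ^ k)%N ->
  `|f (a + i%:Z) (b + j%:Z)| <= 2 ^+ (31 * (64 * (96 * 2 ^ k))).
Proof.
elim: k f a b => [|k IHk] f a b hf.
  (* At k = 0 the square has no bad point at all. *)
  rewrite !muln1 ltnS leqn0 => /eqP bad i j hi hj.
  apply: (@le_trans _ _ 1); last by rewrite exprn_ege1// ler1n.
  have := @sqbad_subrows f a b 64 64 i 1 j 1.
  rewrite bad big_nat1 addr0 => /(_ _ _)/wrap[]; [lia|lia|].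
  rewrite leqn0 /rowbad /= addn0 addr0.
  by rewrite leNgt; case: (1 < _).
rewrite expnS; set r := (2 ^ k)%N => bad i j hi hj.
have r1 : (1 <= r)%N by rewrite expn_gt0.
have D128 : (64 * (2 * r) = 128 * r)%N by lia.
have [c1 [c2 child]] : exists c1 c2 : bool, (sqbad f (a + (c1 * (64 * r))%N%:Z)
    (b + (c2 * (64 * r))%N%:Z) (64 * r) (64 * r) < r * r)%N.
  apply: sqbad_quarter; have -> : (64 * r + 64 * r = 64 * (2 * r))%N by lia.
  by apply: leq_trans bad _; rewrite mulnACA.
have IH := IHk _ _ _ hf child.
rewrite D128 in bad.
set K := 2 ^+ (31 * (64 * (96 * r))) in IH.
have K1 : 1 <= K by rewrite exprn_ege1// ler1n.
have hc1 : (c1 <= 1)%N by exact: leq_b1.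
have hc2 : (c2 <= 1)%N by exact: leq_b1.
(* The centre row of the chosen quarter, 32 r or 96 r, is an end row of the middle of the large
   square, so stretching starts there. *)
have H1 i' j' : (32 * r <= i' <= 96 * r)%N ->
    (16 * r + c2 * (64 * r) <= j' <= 48 * r + c2 * (64 * r))%N ->
    `|f (a + i'%:Z) (b + j'%:Z)| <= 2 ^+ (31 * (32 * r) * 64) * K.
  move=> hi' hj'.
  apply: (@stretch_le f a b r (16 * r + c2 * (64 * r)) (32 * r) c1 K) => //.
  - by clear -r1 hc2; nia.
  - by apply: leq_trans (_ : 8 * ((2 * r) * (2 * r)) <= _)%N;
      [rewrite ltn_mul2l | clear; nia].
  - move=> i'' j'' h1 h2 h3.
    have -> : a + i''%:Z = a + (c1 * (64 * r))%N%:Z + (i'' - c1 * (64 * r))%N%:Z.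
      by clear -r1 h1; lia.
    have -> : b + j''%:Z = b + (c2 * (64 * r))%N%:Z + (j'' - c2 * (64 * r))%N%:Z.
      by clear -r1 h3; lia.
    by apply: IH; [clear -r1 h1 h2; lia|clear -r1 h3; lia].
  - by clear -hj'; lia.
have K2 : 1 <= 2 ^+ (31 * (32 * r) * 64) * K.
  by rewrite -[leLHS]mulr1 ler_pM// exprn_ege1// ler1n.
(* The second stretch exchanges the coordinates and uses windows of width 64 r, the whole middle in
   s. *)
have := @stretch_le (swap f) b a r (32 * r) (64 * r) c2 _ (tilted_swap hf) K2 r1.
move=> /(_ _ _ _ _ j i); rewrite /swap => /(_ _ _ _ _ _ _)/wrap[].
- by clear; lia.
- by clear -r1; lia.
- rewrite sqbad_swap.
  by apply: leq_trans (_ : 8 * ((2 * r) * (2 * r)) <= _)%N;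
      [rewrite ltn_mul2l | clear; nia].
- by move=> j' i' h1 h2 h3; apply: H1; [clear -h3; lia|clear -r1 h1 h2; lia].
- by clear -hj; lia.
- by clear -hi; lia.
(* The two stretches multiply 31 64 by 32 r + 64 r = 96 r, which is the exponent of the quarter: the
   exponent doubles with the side. *)
move/le_trans; apply; rewrite mulrA -!exprD ler_eXn2l ?ltr1n//.
by clear; lia.
Qed.

End TiltedSquares.

(** * Back to the standard lattice *)

Section Tilt.
Variable R : realType.
Implicit Types (u : int * int -> R).

(* The function u in the coordinates s = n + m, t = n - m, extended by 0 to the
   points with s + t odd, which form an independent sublattice for the tilted equation. *)
Definition tilt u : int -> int -> R := fun s t =>
  if (2 %| s + t)%Z then u ((s + t) %/ 2, (s - t) %/ 2)%Z else 0.

Lemma tilt_even u n m : tilt u (n + m) (n - m) = u (n, m).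
Proof.
rewrite /tilt ifT; last by lia.
by congr (u (_, _)); lia.
Qed.

Lemma tilt_odd u n m : tilt u (n + m + 1) (n - m) = 0.
Proof. by rewrite /tilt ifF//; lia. Qed.

Lemma tilt_coords (s t : int) : exists n m : int,
  t = n - m /\ (s = n + m \/ s = n + m + 1).
Proof. by exists ((s + t) %/ 2)%Z, (((s + t) %/ 2)%Z - t); lia. Qed.

Lemma tilted_tilt u : discrete_harmonic u -> tilted_harmonic (tilt u).
Proof.
move=> hu s t; have [n [m [-> [] ->]]] := tilt_coords s t.
  have -> : n + m + 1 = (n + 1) + m by ring.
  have -> : n - m + 1 = (n + 1) - m by ring.
  rewrite tilt_even.
  have -> : tilt u (n + 1 + m) (n - m - 1) = u (n, m + 1).
    by rewrite -tilt_even; congr (tilt u _ _); ring.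
  have -> : tilt u (n + m - 1) (n + 1 - m) = u (n, m - 1).
    by rewrite -tilt_even; congr (tilt u _ _); ring.
  have -> : tilt u (n + m - 1) (n - m - 1) = u (n - 1, m).
    by rewrite -tilt_even; congr (tilt u _ _); ring.
  by rewrite tilt_even (hu n m); field.
have tilt0 s' t' n' m' : s' = n' + m' + 1 -> t' = n' - m' -> tilt u s' t' = 0.
  by move=> -> ->; exact: tilt_odd.
rewrite (tilt0 _ _ (n + 1) m); [|ring|ring].
rewrite (tilt0 _ _ n (m + 1)); [|ring|ring].
rewrite (tilt0 _ _ n (m - 1)); [|ring|ring].
rewrite (tilt0 _ _ (n - 1) m); [|ring|ring].
by rewrite (tilt0 _ _ n m)// !addr0 mulr0.
Qed.

Lemma in_fset_square N p : (p \in fset_set (square N)) = (p \in square N).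
Proof. exact/in_fset_set/finite_square. Qed.

Lemma card_square_le N : (card_set (square N) <= (2 * N).+1 * (2 * N).+1)%N.
Proof.
pose s := [seq (i%:Z - N%:Z, j%:Z - N%:Z) | i <- iota 0 (2 * N).+1, j <- iota 0 (2 * N).+1].
apply: (@leq_trans (size s)); last by rewrite size_allpairs !size_iota.
apply: uniq_leq_size; first exact: fset_uniq.
move=> [n m]; rewrite in_fset_square => /set_mem[/= hn hm]; apply/allpairsP.
exists (absz (n + N%:Z)%R, absz (m + N%:Z)%R); rewrite !mem_iota /=; split; [lia|lia|].
by congr pair; lia.
Qed.

(** The tilted square of side 64 r around (x + y, x - y) comes from points within 32 r of (x, y) in
    each coordinate, all in Q_N. Where s + t is odd the value is 0, so bad points inject into the
    points of Q_N with |u| > 1. *)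
Lemma sqbad_tilt_le u (N r : nat) (x y : int) :
    (`|x| + 32 * r <= N)%N -> (`|y| + 32 * r <= N)%N ->
  (sqbad (tilt u) (x + y - (32 * r)%:Z)%R (x - y - (32 * r)%:Z)%R (64 * r) (64 * r)
    <= card_set (square N) - card_set (square N `&` [set p | (`|u p| <= 1)%R]))%N.
Proof.
move=> hx hy; set a := x + y - _; set b := x - y - _; set l := (64 * r)%N.
set G := _ `&` _.
have finG : finite_set G by apply: sub_finite_set (finite_square N) => p [].
have subG : (fset_set G `<=` fset_set (square N))%fset.
  apply/fsubsetP => p; rewrite in_fset_square (in_fset_set finG) => /set_mem[pN _].
  exact/mem_set.
rewrite /card_set -cardfsDS//.
pose bad (i : nat) := [seq j <- iota 0 l | 1 < `|tilt u (a + i%:Z) (b + j%:Z)|].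
pose P := [seq (i, j) | i <- iota 0 l, j <- bad i].
have -> : sqbad (tilt u) a b l l = size P.
  rewrite size_allpairs_dep sumnE big_map /sqbad /index_iota subn0.
  by apply: eq_bigr => i _; rewrite size_filter.
pose pt (q : nat * nat) : int * int :=
  (((a + q.1%:Z + (b + q.2%:Z)) %/ 2)%Z, ((a + q.1%:Z - (b + q.2%:Z)) %/ 2)%Z).
have mP q : q \in P -> [/\ (q.1 < l)%N, (q.2 < l)%N,
    (2 %| a + q.1%:Z + (b + q.2%:Z))%Z & 1 < `|u (pt q)| ].
  move=> /allpairsPdep[i [j [+ + ->]]]; rewrite mem_filter !mem_iota /=.
  rewrite /tilt /pt /=; case: ifP => [_ hi /andP[hu hj] |_ _]; first by [].
  by rewrite normr0 ltr10.
rewrite -(size_map pt); apply: uniq_leq_size.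
  rewrite map_inj_in_uniq.
    apply: allpairs_uniq_dep; first exact: iota_uniq.
      by move=> i _; rewrite filter_uniq ?iota_uniq.
    by move=> [i j] [i' j'] _ _ /= [-> ->].
  move=> [i j] [i' j'] /mP[/= _ _ e _] /mP[/= _ _ e' _] [h1 h2].
  by congr pair; lia.
move=> _ /mapP[q /mP[q1 q2 e hu] ->].
rewrite in_fsetD in_fset_square (in_fset_set finG); apply/andP; split.
  by apply/negP => /set_mem[_ /=]; rewrite leNgt hu.
apply/mem_set; rewrite /square /pt /=; move: q1 q2 e; rewrite /a /b /l; clear -hx hy.
by move: q.1 q.2 => i j *; split; lia.
Qed.

Lemma expn2_le_expR n : 2 ^+ n <= expR (n%:R : R).
Proof.
rewrite -[n%:R]mulr1 expRM_natl; apply: lerXn2r; rewrite ?nnegrE ?expR_ge0//.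
by rewrite (le_trans _ (expR_ge1Dx 1))//; lra.
Qed.

Lemma expn2_between (x : R) : 1 <= x -> exists k, x < (2 ^ k)%:R <= 2 * x.
Proof.
move=> x1; have ex : exists k, x < (2 ^ k)%:R :> R.
  exists (Num.trunc x).+1; have := truncnS_gt x; move/lt_trans; apply.
  by rewrite ltr_nat ltn_expl.
exists (ex_minn ex); case: ex_minnP => -[|k] hk min; first by move: hk; rewrite expn0; lra.
rewrite hk /=; have := contraNN (min k); rewrite -ltnNge ltnSn => /(_ isT).
by rewrite -leNgt expnS natrM; lra.
Qed.

End Tilt.

(** * Choice of the scale and conclusion *)

Theorem mainTheorem2 (R : realType) :
  exists (eps0 : R) (a N0 : R -> R),
    [/\ 0 < eps0,
        (forall eps : R, 0 < eps < eps0 -> 0 < a eps /\ 0 < N0 eps),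
        a eps @[eps --> 0^'+] --> (0 : R)
      & forall (eps : R) (N : nat) (u : int * int -> R),
          0 < eps < eps0 ->
          N0 eps < N%:R ->
          discrete_harmonic u ->
          (1 - eps) * (card_set (square N))%:R
            <= (card_set (square N `&` [set p | `|u p| <= 1]))%:R :> R ->
          max_abs u (square (N %/ 2)) <= expR (a eps * N%:R)].
Proof.
(* The exponent of [square_le] is 31 64 96 r, and r will be at most 6 sqrt(eps) N. *)
pose C : R := 31 * 64 * 96 * 6.
have C0 : 0 < C by rewrite /C; lra.
have c0 : 0 < 400^-1 :> R by rewrite invr_gt0 ltr0n.
(* The first value gives 64 r <= 384 sqrt(eps) N <= N; the last one gives sqrt(eps) N > 1, so a
   power of 2 can be chosen between 3 sqrt(eps) N and twice that. *)
exists (400^-1 ^+ 2), (fun eps => C * Num.sqrt eps), (fun eps => (Num.sqrt eps)^-1); split.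
- exact: exprn_gt0.
- by move=> eps /andP[e0 _]; rewrite mulr_gt0// ?invr_gt0 sqrtr_gt0.
- have lim : C * Num.sqrt eps @[eps --> (0 : R)] --> C * Num.sqrt 0.
    by apply: cvgM; [exact: cvg_cst|exact: sqrt_continuous].
  by rewrite sqrtr0 mulr0 in lim; exact: cvg_at_right_filter.
move=> eps N u /andP[e0 e1] hN hu hbad.
set d := Num.sqrt eps in hN *.
have d0 : 0 < d by rewrite sqrtr_gt0.
have ed : eps = d ^+ 2 by rewrite sqr_sqrtr// ltW.
have d1 : d < 400^-1.
  by rewrite -(@ltr_pXn2r _ 2)// ?nnegrE ?invr_ge0// ?ltW// -ed.
have dN : 1 < d * N%:R by rewrite -ltr_pdivrMl ?mulr1.
have [k /andP[k1 k2]] : exists k, 3 * (d * N%:R) < (2 ^ k)%:R <= 2 * (3 * (d * N%:R)).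
  by apply: expn2_between; lra.
set r := (2 ^ k)%N in k1 k2.
have N1 : 1 <= N%:R :> R by nra.
have rN : (64 * r <= N)%N by rewrite -(ler_nat R) natrM; nra.
rewrite /max_abs big_seq; apply: bigmax_le; first exact: expR_ge0.
move=> [x y]; rewrite in_fset_square => /set_mem[/= hx hy].
have hx' : (`|x| + 32 * r <= N)%N by clear -hx rN; lia.
have hy' : (`|y| + 32 * r <= N)%N by clear -hy rN; lia.
have := @square_le R k (tilt u) (x + y - (32 * r)%:Z) (x - y - (32 * r)%:Z) (tilted_tilt hu).
have small : (sqbad (tilt u) (x + y - (32 * r)%:Z)%R (x - y - (32 * r)%:Z)%R
    (64 * r) (64 * r) < r * r)%N.
  have le_bad := @sqbad_tilt_le R u N r x y hx' hy'; apply: leq_ltn_trans le_bad _.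
  have le_card : (card_set (square N `&` [set p | (`|u p| <= 1)%R]) <= card_set (square N))%N.
    apply: fsubset_leq_card; apply/fsubsetP => p.
    rewrite in_fset_square in_fset_set => [/set_mem[pN _]|]; first exact/mem_set.
    by apply: sub_finite_set (finite_square N) => q [].
  rewrite -(ltr_nat R) natrB// natrM.
  have : (card_set (square N))%:R <= 9 * (N%:R * N%:R) :> R.
    have := card_square_le N; rewrite -(ler_nat R) natrM -natr1 natrM => /le_trans; apply.
    by nra.
  move: (card_set _)%:R (card_set _)%:R hbad => c1 c2 hbad hc.
  (* There are at most eps |Q_N| <= 9 eps N^2 = (3 d N)^2 < r^2 bad points. *)
  apply: (@le_lt_trans _ _ ((3 * (d * N%:R)) * (3 * (d * N%:R)))); last by nra.
  by rewrite ed in hbad; nra.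
(* The point (x, y) has index 32 r in both tilted coordinates, the centre of its square. *)
move=> /(_ small (32 * r)%N (32 * r)%N _ _)/wrap[]; [clear; lia|clear; lia|].
have -> : x + y - (32 * r)%:Z + (32 * r)%:Z = x + y by ring.
have -> : x - y - (32 * r)%:Z + (32 * r)%:Z = x - y by ring.
rewrite tilt_even => /le_trans; apply.
apply: (le_trans (expn2_le_expR _ _)); rewrite ler_expR !natrM /C.
by lra.
Qed.
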